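(* Let $\mathbf{K}$ be a field of characteristic $0$, let $X$ be a totally ordered set, and let $f\in Bicom(X)$. Then $f$ is a Jordan element if and only if $f$ is symmetric, i.e. $f^{\ast}=f$.
   Context: An algebra over $\mathbf{K}$ (not necessarily associative or unital) is bicommutative if it satisfies $a(bc)=b(ac)$ and $(ab)c=(ac)b$. $Bicom(X)$ denotes the free bicommutative algebra over $\mathbf{K}$ generated by $X$. Base elements: for $x_1,\dots,x_k,y_1,\dots,y_l\in X$ with $k,l\ge 1$ put $$e(x_1,\dots,x_k;\,y_1,\dots,y_l)=x_k(\cdots(x_2((\cdots((x_1y_1)y_2)\cdots)y_l))\cdots).$$ (In the paper this is drawn as a hook Young diagram with first column $x_1,\dots,x_k$ and first row $x_1,y_1,\dots,y_l$.) It is known that the elements of $X$ together with all $e(x_1,\dots,x_k;y_1,\dots,y_l)$ with $k,l\ge 1$, $x_1\le\dots\le x_k$ and $y_1\le\dots\le y_l$ form a linear basis of $Bicom(X)$. The linear map $\ast:Bicom(X)\to Bicom(X)$ is defined on this basis by $x^{\ast}=x$ for $x\in X$ and $e(x_1,\dots,x_k;y_1,\dots,y_l)^{\ast}=e(y_1,\dots,y_l;x_1,\dots,x_k)$. Put $\{a,b\}=ab+ba$. An element of $Bicom(X)$ is called Jordan if it belongs to $J(X)$, the smallest linear subspace of $Bicom(X)$ that contains $X$ and is closed under $\{\cdot,\cdot\}$. *)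

(* Defs.v *)
From HB Require Import structures.
From mathcomp Require Import all_boot all_order all_algebra.
From mathcomp Require Import boolp classical_sets.

Set Implicit Arguments.
Unset Strict Implicit.
Unset Printing Implicit Defensive.

Import Order.TTheory GRing.Theory.
Local Open Scope ring_scope.
Local Open Scope quotient_scope.

Record bicommutative (K : fieldType) (A : lmodType K) (m : A -> A -> A) : Prop :=
  Bicommutative {
    bicom_linear_r : forall a, linear (m a);
    bicom_linear_l : forall b, linear (m^~ b);
    bicom_left : forall a b c, m a (m b c) = m b (m a c);
    bicom_right : forall a b c, m (m a b) c = m (m a c) b
  }.

(* The free bicommutative algebra is built as formal algebraic expressions in X
   modulo the least congruence that contains the axioms of a K-algebra and the
   two bicommutative identities; lemmas [bicom_lift] and [bicom_lift_uniq] give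
   its universal property. *)
Inductive expr (K : fieldType) (X : Type) : Type :=
| EGen of X
| EZero
| EAdd of expr K X & expr K X
| EOpp of expr K X
| EScale of K & expr K X
| EMul of expr K X & expr K X.
Arguments EGen {K X}.
Arguments EZero {K X}.

HB.instance Definition _ (K : fieldType) (X : Type) := gen_eqMixin (expr K X).
HB.instance Definition _ (K : fieldType) (X : Type) := gen_choiceMixin (expr K X).

Inductive expr_eqv (K : fieldType) (X : Type) : expr K X -> expr K X -> Prop :=
| eqv_refl s : expr_eqv s s
| eqv_sym s t : expr_eqv s t -> expr_eqv t s
| eqv_trans s t u : expr_eqv s t -> expr_eqv t u -> expr_eqv s u
| eqv_add s s' t t' :
    expr_eqv s s' -> expr_eqv t t' -> expr_eqv (EAdd s t) (EAdd s' t')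
| eqv_opp s s' : expr_eqv s s' -> expr_eqv (EOpp s) (EOpp s')
| eqv_scale k s s' : expr_eqv s s' -> expr_eqv (EScale k s) (EScale k s')
| eqv_mul s s' t t' :
    expr_eqv s s' -> expr_eqv t t' -> expr_eqv (EMul s t) (EMul s' t')
| eqv_addA s t u : expr_eqv (EAdd s (EAdd t u)) (EAdd (EAdd s t) u)
| eqv_addC s t : expr_eqv (EAdd s t) (EAdd t s)
| eqv_add0 s : expr_eqv (EAdd EZero s) s
| eqv_addN s : expr_eqv (EAdd (EOpp s) s) EZero
| eqv_scaleA k l s : expr_eqv (EScale k (EScale l s)) (EScale (k * l) s)
| eqv_scale1 s : expr_eqv (EScale 1 s) s
| eqv_scaleDr k s t :
    expr_eqv (EScale k (EAdd s t)) (EAdd (EScale k s) (EScale k t))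
| eqv_scaleDl k l s :
    expr_eqv (EScale (k + l) s) (EAdd (EScale k s) (EScale l s))
| eqv_mulDl s t u : expr_eqv (EMul (EAdd s t) u) (EAdd (EMul s u) (EMul t u))
| eqv_mulDr s t u : expr_eqv (EMul s (EAdd t u)) (EAdd (EMul s t) (EMul s u))
| eqv_mulZl k s t : expr_eqv (EMul (EScale k s) t) (EScale k (EMul s t))
| eqv_mulZr k s t : expr_eqv (EMul s (EScale k t)) (EScale k (EMul s t))
| eqv_mul_left s t u : expr_eqv (EMul s (EMul t u)) (EMul t (EMul s u))
| eqv_mul_right s t u : expr_eqv (EMul (EMul s t) u) (EMul (EMul s u) t).

Definition expr_eqvb (K : fieldType) (X : Type) : rel (expr K X) :=
  fun s t => `[< expr_eqv s t >].

Lemma expr_eqvb_class (K : fieldType) (X : Type) :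
  equiv_class_of (@expr_eqvb K X).
Proof.
split=> [s|s t|t s u]; first by apply/asboolP/eqv_refl.
- by apply/asboolP/asboolP => /eqv_sym.
- by move=> /asboolP st /asboolP tu; apply/asboolP/(eqv_trans st tu).
Qed.

Canonical expr_equiv (K : fieldType) (X : Type) :=
  EquivRelPack (expr_eqvb_class K X).

Definition Bicom (K : fieldType) (X : Type) : Type := {eq_quot @expr_eqvb K X}.

HB.instance Definition _ (K : fieldType) (X : Type) := Choice.on (Bicom K X).
HB.instance Definition _ (K : fieldType) (X : Type) := EqQuotient.on (Bicom K X).

Section BicomOps.
Context (K : fieldType) (X : Type).
Local Notation B := (Bicom K X).
Implicit Types (s t : expr K X) (a b c : B) (k : K).

Lemma bicom_eqP s t : reflect (\pi_B s = \pi_B t) `[< expr_eqv s t >].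
Proof. exact: eqmodP. Qed.

Lemma bicom_eq s t : expr_eqv s t -> \pi_B s = \pi_B t.
Proof. by move=> st; apply/bicom_eqP/asboolP. Qed.

Lemma repr_bicom s : expr_eqv (repr (\pi_B s)) s.
Proof. by apply/asboolP/bicom_eqP; rewrite reprK. Qed.

Definition gen (x : X) : B := \pi_B (EGen x).
Definition bicom_zero : B := \pi_B EZero.
Definition bicom_add a b : B := \pi_B (EAdd (repr a) (repr b)).
Definition bicom_opp a : B := \pi_B (EOpp (repr a)).
Definition bicom_scale k a : B := \pi_B (EScale k (repr a)).
Definition bicom_mul a b : B := \pi_B (EMul (repr a) (repr b)).

Lemma pi_add s t : bicom_add (\pi_B s) (\pi_B t) = \pi_B (EAdd s t).
Proof. by apply: bicom_eq; apply: eqv_add; apply: repr_bicom. Qed.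

Lemma pi_opp s : bicom_opp (\pi_B s) = \pi_B (EOpp s).
Proof. by apply: bicom_eq; apply: eqv_opp; apply: repr_bicom. Qed.

Lemma pi_scale k s : bicom_scale k (\pi_B s) = \pi_B (EScale k s).
Proof. by apply: bicom_eq; apply: eqv_scale; apply: repr_bicom. Qed.

Lemma pi_mul s t : bicom_mul (\pi_B s) (\pi_B t) = \pi_B (EMul s t).
Proof. by apply: bicom_eq; apply: eqv_mul; apply: repr_bicom. Qed.

Lemma bicom_addA : associative bicom_add.
Proof.
elim/quotW=> s; elim/quotW=> t; elim/quotW=> u.
by rewrite (pi_add t u) (pi_add s t) !pi_add; apply/bicom_eq/eqv_addA.
Qed.

Lemma bicom_addC : commutative bicom_add.
Proof.
by elim/quotW=> s; elim/quotW=> t; rewrite !pi_add; apply/bicom_eq/eqv_addC.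
Qed.

Lemma bicom_add0 : left_id bicom_zero bicom_add.
Proof. by elim/quotW=> s; rewrite pi_add; apply/bicom_eq/eqv_add0. Qed.

Lemma bicom_addN : left_inverse bicom_zero bicom_opp bicom_add.
Proof. by elim/quotW=> s; rewrite pi_opp pi_add; apply/bicom_eq/eqv_addN. Qed.

HB.instance Definition _ :=
  GRing.isZmodule.Build B bicom_addA bicom_addC bicom_add0 bicom_addN.

Lemma bicom_scaleA k l a :
  bicom_scale k (bicom_scale l a) = bicom_scale (k * l) a.
Proof.
by elim/quotW: a => s; rewrite (pi_scale l s) !pi_scale; apply/bicom_eq/eqv_scaleA.
Qed.

Lemma bicom_scale1 : left_id 1 bicom_scale.
Proof. by elim/quotW=> s; rewrite pi_scale; apply/bicom_eq/eqv_scale1. Qed.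

Lemma bicom_scaleDr : right_distributive bicom_scale +%R.
Proof.
move=> k; elim/quotW=> s; elim/quotW=> t.
rewrite -[_ + _]/(bicom_add _ _) -[RHS]/(bicom_add _ _).
by rewrite (pi_add s t) !(pi_scale k) pi_add; apply/bicom_eq/eqv_scaleDr.
Qed.

Lemma bicom_scaleDl a : {morph bicom_scale^~ a : k l / k + l}.
Proof.
elim/quotW: a => s k l; rewrite -[RHS]/(bicom_add _ _).
by rewrite (pi_scale k) (pi_scale l) pi_add pi_scale; apply/bicom_eq/eqv_scaleDl.
Qed.

HB.instance Definition _ := GRing.Zmodule_isLmodule.Build K B
  bicom_scaleA bicom_scale1 bicom_scaleDr bicom_scaleDl.

Lemma piD s t : \pi_B (EAdd s t) = \pi_B s + \pi_B t.
Proof. by rewrite -pi_add. Qed.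

Lemma piN s : \pi_B (EOpp s) = - \pi_B s.
Proof. by rewrite -pi_opp. Qed.

Lemma piZ k s : \pi_B (EScale k s) = k *: \pi_B s.
Proof. by rewrite -pi_scale. Qed.

Lemma bicom_mulP : bicommutative bicom_mul.
Proof.
split.
- move=> a k b c; elim/quotW: a => s; elim/quotW: b => t; elim/quotW: c => u.
  rewrite -piZ -piD (pi_mul s t) (pi_mul s u) pi_mul -piZ -piD; apply/bicom_eq.
  apply: eqv_trans (eqv_mulDr _ _ _) _; apply: eqv_add; last exact: eqv_refl.
  exact: eqv_mulZr.
- move=> a k b c; elim/quotW: a => s; elim/quotW: b => t; elim/quotW: c => u.
  rewrite -piZ -piD (pi_mul t s) (pi_mul u s) pi_mul -piZ -piD; apply/bicom_eq.
  apply: eqv_trans (eqv_mulDl _ _ _) _; apply: eqv_add; last exact: eqv_refl.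
  exact: eqv_mulZl.
- move=> a b c; elim/quotW: a => s; elim/quotW: b => t; elim/quotW: c => u.
  by rewrite (pi_mul t u) (pi_mul s u) !pi_mul; apply/bicom_eq/eqv_mul_left.
- move=> a b c; elim/quotW: a => s; elim/quotW: b => t; elim/quotW: c => u.
  by rewrite (pi_mul s t) (pi_mul s u) !pi_mul; apply/bicom_eq/eqv_mul_right.
Qed.

End BicomOps.

Arguments gen {K X} x.
Notation "a ** b" := (bicom_mul a b)
  (at level 40, left associativity) : ring_scope.

Section Universal.
Context (K : fieldType) (X : Type).
Local Notation B := (Bicom K X).
Context (A : lmodType K) (m : A -> A -> A) (mP : bicommutative m) (h : X -> A).

Fixpoint expr_eval (s : expr K X) : A :=
  match s with
  | EGen x => h x
  | EZero => 0
  | EAdd s t => expr_eval s + expr_eval t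
  | EOpp s => - expr_eval s
  | EScale k s => k *: expr_eval s
  | EMul s t => m (expr_eval s) (expr_eval t)
  end.

Lemma expr_eval_eqv s t : expr_eqv s t -> expr_eval s = expr_eval t.
Proof.
case: mP => lr ll cl cr.
have mDr a b c : m a (b + c) = m a b + m a c.
  by have := lr a 1 b c; rewrite !scale1r.
have mDl a b c : m (b + c) a = m b a + m c a.
  by have := ll a 1 b c; rewrite !scale1r.
have m0r a : m a 0 = 0 by apply: (addrI (m a 0)); rewrite -mDr !addr0.
have m0l a : m 0 a = 0 by apply: (addrI (m 0 a)); rewrite -mDl !addr0.
have mZr a k b : m a (k *: b) = k *: m a b.
  by have := lr a k b 0; rewrite m0r !addr0.
have mZl a k b : m (k *: b) a = k *: m b a.
  by have := ll a k b 0; rewrite m0l !addr0.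
by elim=> //=; intros; rewrite ?(mDr, mDl, mZr, mZl);
   try congruence; rewrite ?(addrA, add0r, addNr, scalerA, scale1r,
   scalerDr, scalerDl) //; rewrite addrC.
Qed.

Definition bicom_eval (a : B) : A := expr_eval (repr a).

Lemma bicom_eval_pi s : bicom_eval (\pi_B s) = expr_eval s.
Proof. exact/expr_eval_eqv/repr_bicom. Qed.

Lemma bicom_eval_linear : linear bicom_eval.
Proof.
move=> k; elim/quotW=> s; elim/quotW=> t.
by rewrite -piZ -piD !bicom_eval_pi.
Qed.

Lemma bicom_lift :
  exists phi : {linear B -> A},
    (forall x, phi (gen x) = h x) /\
    (forall a b, phi (a ** b) = m (phi a) (phi b)).
Proof.
pose L := GRing.isLinear.Build K B A _ bicom_eval bicom_eval_linear.
pose phi : {linear B -> A} := HB.pack bicom_eval L.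
exists phi; split=> [x|]; first exact: bicom_eval_pi.
elim/quotW=> s; elim/quotW=> t.
by rewrite pi_mul /= !bicom_eval_pi.
Qed.

Lemma bicom_lift_uniq (phi psi : {linear B -> A}) :
    (forall x, phi (gen x) = h x) ->
    (forall a b, phi (a ** b) = m (phi a) (phi b)) ->
    (forall x, psi (gen x) = h x) ->
    (forall a b, psi (a ** b) = m (psi a) (psi b)) ->
  phi =1 psi.
Proof.
move=> p1 p2 q1 q2; elim/quotW; elim=> [x||s IHs t IHt|s IHs|k s IHs|s IHs t IHt].
- by rewrite -[\pi_B _]/(gen x) p1 q1.
- by rewrite -[\pi_B _]/(0 : B) !linear0.
- by rewrite piD !linearD IHs IHt.
- by rewrite piN !linearN IHs.
- by rewrite piZ !linearZ IHs.
- by rewrite -pi_mul p2 q2 IHs IHt.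
Qed.

End Universal.

(* [hook x1 [:: x2; ..; xk] y1 [:: y2; ..; yl]] is the base element
   e(x1, .., xk; y1, .., yl); splitting off x1 and y1 encodes k, l >= 1. *)
Definition hook (K : fieldType) (X : Type) (x1 : X) (xs : seq X)
    (y1 : X) (ys : seq X) : Bicom K X :=
  foldl (fun u x => gen x ** u)
    (foldl (fun u y => u ** gen y) (gen x1 ** gen y1) ys) xs.

Section Hook.
Context (K : fieldType) (X : Type).
Local Notation B := (Bicom K X).
Implicit Types (a b c : B).

Lemma bicom_mulCl a b c : a ** (b ** c) = b ** (a ** c).
Proof. by case: (bicom_mulP K X). Qed.

Lemma bicom_mulCr a b c : a ** b ** c = a ** c ** b.
Proof. by case: (bicom_mulP K X). Qed.

Lemma bicom_mulLR a b c d : a ** (c ** d ** b) = a ** (c ** d) ** b.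
Proof.
by rewrite (bicom_mulCr c d b) (bicom_mulCl a) (bicom_mulCr c b) (bicom_mulCl c a).
Qed.

Local Notation lmul := (fun u x => gen x ** u).
Local Notation rmul := (fun u y => u ** gen y).

Lemma lmul_foldl x xs (u : B) :
  foldl lmul (gen x ** u) xs = gen x ** foldl lmul u xs.
Proof. by elim: xs u => //= z xs IH u; rewrite bicom_mulCl IH. Qed.

Lemma rmul_foldl y ys (u : B) :
  foldl rmul (u ** gen y) ys = foldl rmul u ys ** gen y.
Proof. by elim: ys u => //= z ys IH u; rewrite bicom_mulCr IH. Qed.

Lemma lmul_rmul_foldl x ys a b :
  foldl rmul (gen x ** (a ** b)) ys = gen x ** foldl rmul (a ** b) ys.
Proof. by elim: ys a b => //= y ys IH a b; rewrite -bicom_mulLR IH. Qed.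

Lemma foldl_lmul_rmul xs ys a b :
  foldl lmul (foldl rmul (a ** b) ys) xs = foldl rmul (foldl lmul (a ** b) xs) ys.
Proof.
elim: xs a b => //= x xs IH a b.
by rewrite -lmul_rmul_foldl IH.
Qed.

Lemma hookC (x1 y1 : X) xs ys :
  hook K x1 xs y1 ys = foldl rmul (foldl lmul (gen x1 ** gen y1) xs) ys.
Proof. exact: foldl_lmul_rmul. Qed.

Lemma hook_swapl (x1 x2 : X) xs y1 ys :
  hook K x1 (x2 :: xs) y1 ys = hook K x2 (x1 :: xs) y1 ys.
Proof. by rewrite !hookC /= bicom_mulCl. Qed.

Lemma hook_swapr (x1 : X) xs y1 y2 ys :
  hook K x1 xs y1 (y2 :: ys) = hook K x1 xs y2 (y1 :: ys).
Proof. by rewrite /hook /= bicom_mulCr. Qed.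

Lemma hook_lmul (x x1 : X) xs y1 ys :
  gen x ** hook K x1 xs y1 ys = hook K x1 (x :: xs) y1 ys.
Proof. by rewrite /hook /= lmul_foldl. Qed.

Lemma hook_rmul (y x1 : X) xs y1 ys :
  hook K x1 xs y1 ys ** gen y = hook K x1 xs y1 (y :: ys).
Proof. by rewrite !hookC /= rmul_foldl. Qed.

End Hook.

Section HookPerm.
Context (K : fieldType) (X : eqType).
Local Notation B := (Bicom K X).

Lemma foldl_perm (f : B -> X -> B) :
    (forall u x y, f (f u x) y = f (f u y) x) ->
  forall xs zs u, perm_eq xs zs -> foldl f u xs = foldl f u zs.
Proof.
move=> fC; have fm x s u : foldl f (f u x) s = f (foldl f u s) x.
  by elim: s u => //= z s IH u; rewrite fC IH.
elim=> [|x xs IH] zs u; first by rewrite perm_sym => /perm_nilP ->.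
move=> p; have xz : x \in zs by rewrite -(perm_mem p) mem_head.
case/splitPr: xz p => z1 z2 p; rewrite foldl_cat /= -fm -foldl_cat.
by apply: IH; rewrite -(perm_cons x) (perm_trans p) // -cat1s perm_catCA.
Qed.

Lemma hook_perm (x1 : X) xs z1 zs y1 ys t1 ts :
    perm_eq (x1 :: xs) (z1 :: zs) -> perm_eq (y1 :: ys) (t1 :: ts) ->
  hook K x1 xs y1 ys = hook K z1 zs t1 ts.
Proof.
have pl (a : X) as_ bs c cs : perm_eq as_ bs ->
    hook K a as_ c cs = hook K a bs c cs.
  by move=> p; rewrite /hook; apply: foldl_perm p => u x y; rewrite bicom_mulCl.
have pr (a : X) as_ c cs ds : perm_eq cs ds ->
    hook K a as_ c cs = hook K a as_ c ds.
  move=> p; rewrite /hook; congr foldl.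
  by apply: foldl_perm p => u x y; rewrite bicom_mulCr.
move=> px py; apply: (@etrans _ _ (hook K z1 zs y1 ys)).
  case: (eqVneq x1 z1) px => [<-|ne px]; first by rewrite perm_cons => /pl->.
  have zin : z1 \in xs.
    by have := mem_head z1 zs; rewrite -(perm_mem px) inE eq_sym (negPf ne).
  have pz := perm_to_rem zin.
  rewrite (pl _ _ _ _ _ pz) hook_swapl; apply: pl => //.
  rewrite -(perm_cons z1) perm_sym (perm_trans _ (_ : perm_eq (x1 :: z1 :: rem z1 xs) _)) //.
    by rewrite perm_sym in px; apply: (perm_trans px); rewrite perm_cons.
  by rewrite -(cat1s x1) -(cat1s z1) perm_catCA.
case: (eqVneq y1 t1) py => [<-|ne py]; first by rewrite perm_cons => /pr->.
have tin : t1 \in ys.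
  by have := mem_head t1 ts; rewrite -(perm_mem py) inE eq_sym (negPf ne).
have pt := perm_to_rem tin.
rewrite (pr _ _ _ _ _ pt) hook_swapr; apply: pr.
rewrite -(perm_cons t1) perm_sym (perm_trans _ (_ : perm_eq (y1 :: t1 :: rem t1 ys) _)) //.
  by rewrite perm_sym in py; apply: (perm_trans py); rewrite perm_cons.
by rewrite -(cat1s y1) -(cat1s t1) perm_catCA.
Qed.

End HookPerm.

Section Star.
Context (K : fieldType) (d : Order.disp_t) (X : orderType d).
Local Notation B := (Bicom K X).

(* By [bicom_ind] the listed elements span, so [star_spec] determines [s]
   ([star_uniq]); linear independence of the basis is not needed here. *)
Definition star_spec (s : {linear B -> B}) : Prop :=
  (forall x : X, s (gen x) = gen x) /\
  (forall (x1 : X) xs (y1 : X) ys,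
     sorted <=%O (x1 :: xs) -> sorted <=%O (y1 :: ys) ->
     s (hook K x1 xs y1 ys) = hook K y1 ys x1 xs).

Lemma star_exists : exists s : {linear B -> B}, star_spec s.
Proof.
have op : bicommutative (fun a b : B => b ** a).
  case: (bicom_mulP K X) => lr ll cl cr; split.
  - exact: ll.
  - exact: lr.
  - by move=> a b c; rewrite cr.
  - by move=> a b c; rewrite cl.
have [s [sg sm]] := bicom_lift op (@gen K X); exists s; split=> // x1 xs y1 ys _ _.
have sl zs u : s (foldl (fun u x => gen x ** u) u zs) =
               foldl (fun u x => u ** gen x) (s u) zs.
  by elim: zs u => //= z zs IH u; rewrite IH sm sg.
have sr zs u : s (foldl (fun u x => u ** gen x) u zs) =
               foldl (fun u x => gen x ** u) (s u) zs.
  by elim: zs u => //= z zs IH u; rewrite IH sm sg.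
by rewrite /hook sl sr sm !sg -foldl_lmul_rmul.
Qed.

Lemma bicom_ind (P : B -> Prop) :
    P 0 -> (forall k a b, P a -> P b -> P (k *: a + b)) ->
    (forall x : X, P (gen x)) ->
    (forall (x1 : X) xs (y1 : X) ys,
       sorted <=%O (x1 :: xs) -> sorted <=%O (y1 :: ys) ->
       P (hook K x1 xs y1 ys)) ->
  forall a, P a.
Proof.
move=> P0 PD Pg Ph.
have Phk (x1 : X) xs y1 ys : P (hook K x1 xs y1 ys).
  have : perm_eq (x1 :: xs) (sort <=%O (x1 :: xs)) by rewrite perm_sym perm_sort.
  have : perm_eq (y1 :: ys) (sort <=%O (y1 :: ys)) by rewrite perm_sym perm_sort.
  have := sort_le_sorted (x1 :: xs); have := sort_le_sorted (y1 :: ys).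
  case: (sort _ (x1 :: xs)) => [|z1 zs]; first by move=> _ _ _ /perm_size.
  case: (sort _ (y1 :: ys)) => [|t1 ts]; first by move=> _ _ /perm_size.
  by move=> st sz pt pz; rewrite (hook_perm K pz pt); apply: Ph.
pose S (a : B) := forall Q : B -> Prop, Q 0 ->
  (forall k a b, Q a -> Q b -> Q (k *: a + b)) -> (forall x, Q (gen x)) ->
  (forall (x1 : X) xs y1 ys, Q (hook K x1 xs y1 ys)) -> Q a.
suff SS : forall a, S a by move=> a; exact: (SS a P P0 PD Pg Phk).
have S0 : S 0 by move=> Q.
have SD k a b : S a -> S b -> S (k *: a + b).
  move=> Sa Sb Q Q0 QD Qg Qh.
  by apply: (QD); [exact: (Sa Q Q0 QD Qg Qh)|exact: (Sb Q Q0 QD Qg Qh)].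
have Sg x : S (gen x) by move=> Q Q0 QD Qg Qh; apply: Qg.
have Sh (x1 : X) xs y1 ys : S (hook K x1 xs y1 ys) by move=> Q Q0 QD Qg Qh; apply: Qh.
have SA a b : S a -> S b -> S (a + b).
  by move=> Sa Sb; rewrite -[a]scale1r; apply: SD.
have SZ k a : S a -> S (k *: a) by move=> Sa; rewrite -[_ *: _]addr0; apply: SD.
case: (bicom_mulP K X) => lr ll cl cr.
pose R (a : B) := S a /\ forall b, S b -> S (a ** b) /\ S (b ** a).
suff RR : forall a, R a by move=> a; case: (RR a).
have m0r u : u ** (0 : B) = 0.
  by have := lr u (-1) 0 0; rewrite !scaleN1r !addNr.
have m0l u : (0 : B) ** u = 0.
  by have := ll u (-1) 0 0; rewrite !scaleN1r !addNr.
have mDr (u v w : B) : u ** (v + w) = u ** v + u ** w.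
  by have := lr u 1 v w; rewrite !scale1r.
have mDl (u v w : B) : (v + w) ** u = v ** u + w ** u.
  by have := ll u 1 v w; rewrite !scale1r.
have mZr (u : B) k v : u ** (k *: v) = k *: (u ** v).
  by have := lr u k v 0; rewrite m0r !addr0.
have mZl (u : B) k v : (k *: v) ** u = k *: (v ** u).
  by have := ll u k v 0; rewrite m0l !addr0.
elim/quotW; elim=> [x||s [Ss Rs] t [St Rt]|s [Ss Rs]|k s [Ss Rs]|s [Ss Rs] t [St Rt]].
- rewrite -[\pi_B _]/(gen x); split=> // b Sb.
  apply: (Sb (fun b => S (gen x ** b) /\ S (b ** gen x))).
  + by rewrite m0r m0l.
  + by move=> k u v [? ?] [? ?]; rewrite mDr mDl mZr mZl; split; apply: SD.
  + by move=> z; split; [apply: (Sh x [::] z [::])|apply: (Sh z [::] x [::])].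
  + by move=> x1 xs y1 ys; rewrite hook_lmul hook_rmul.
- by rewrite -[\pi_B _]/(0 : B); split=> // b _; rewrite m0r m0l.
- rewrite piD; split=> [|b Sb]; first exact: SA.
  by rewrite mDl mDr; have [? ?] := Rs b Sb; have [? ?] := Rt b Sb; split; apply: SA.
- rewrite piN -scaleN1r; split=> [|b Sb]; first exact: SZ.
  by rewrite mZl mZr; have [? ?] := Rs b Sb; split; apply: SZ.
- rewrite piZ; split=> [|b Sb]; first exact: SZ.
  by rewrite mZl mZr; have [? ?] := Rs b Sb; split; apply: SZ.
- rewrite -pi_mul; split=> [|b Sb]; first by case: (Rs _ St).
  rewrite cr [b ** _]cl; split.
  + by have [Sb' _] := Rs b Sb; case: (Rt _ Sb').
  + by have [_ Sb'] := Rt b Sb; case: (Rs _ Sb').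
Qed.

Lemma star_uniq (s s' : {linear B -> B}) : star_spec s -> star_spec s' -> s =1 s'.
Proof.
move=> [sg sh] [sg' sh']; elim/bicom_ind => [|k a b IHa IHb|x|x1 xs y1 ys sx sy].
- by rewrite !linear0.
- by rewrite !linearP IHa IHb.
- by rewrite sg sg'.
- by rewrite sh ?sh'.
Qed.

Definition star : {linear B -> B} := sval (cid star_exists).

Lemma starP : star_spec star.
Proof. exact: svalP (cid star_exists). Qed.

End Star.

Local Open Scope classical_set_scope.

Definition anticomm (K : fieldType) (X : Type) (a b : Bicom K X) : Bicom K X :=
  a ** b + b ** a.

Record jordan_closed (K : fieldType) (X : Type) (V : set (Bicom K X)) : Prop :=
  JordanClosed {
    jordan_closed0 : V 0;
    jordan_closed_lin : forall k a b, V a -> V b -> V (k *: a + b);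
    jordan_closed_anticomm : forall a b, V a -> V b -> V (anticomm a b)
  }.

Definition jordan (K : fieldType) (X : Type) : set (Bicom K X) :=
  smallest (@jordan_closed K X) (range gen).

(* Main.v *)
Require Import Defs.
From mathcomp Require Import all_boot all_order all_algebra.
From mathcomp Require Import ssrAC.
Import GRing.Theory.
Local Open Scope ring_scope.

(** The involution [star] is an anti-automorphism, so its fixed points form a
    subspace containing X and closed under the anticommutator.  Conversely, let
    s(A; B) = e(A; B) + e(B; A) = s(B; A); as 2 is invertible it is enough to
    show by induction on |A| + |B| that every s(A; B) is Jordan.  Since
    {z, s(A; B)} = s(zA; B) + s(A; zB), a letter can be moved from one side to
    the other modulo Jordan elements, at the cost of a sign; moving two letters,
    s(aA; bB) and s(bA; aB) are congruent if A is nonempty.  If B is nonempty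
    too, then {s(a; b), s(A; B)} is twice
    s(aA; bB) + s(bA; aB), hence congruent to 4 s(aA; bB).  The case |A| = 1 is
    reduced to this one by moving a letter, except in degree 3, where the
    three sums of two of s(ab; c), s(ac; b), s(bc; a) are Jordan. *)

Section JordanSubspace.
Context {K : fieldType} {X : Type}.
Implicit Types (a b : Bicom K X) (k : K).

Lemma jordan_closed_jordan : jordan_closed (@jordan K X).
Proof.
split=> [V [VJ _]|k a b Ja Jb V [VJ Vg]|a b Ja Jb V [VJ Vg]].
- by case: VJ.
- by case: (VJ) => _ + _; apply; [apply: Ja|apply: Jb].
- by case: (VJ) => _ _; apply; [apply: Ja|apply: Jb].
Qed.

Lemma jordan_gen (x : X) : jordan (gen x : Bicom K X).
Proof. by move=> V [_ Vg]; apply: Vg; exists x. Qed.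

Lemma jordan0 : jordan (0 : Bicom K X).
Proof. by case: jordan_closed_jordan. Qed.

Lemma jordanP k a b : jordan a -> jordan b -> jordan (k *: a + b).
Proof. by case: jordan_closed_jordan => _ + _; apply. Qed.

Lemma jordan_anticomm a b : jordan a -> jordan b -> jordan (anticomm a b).
Proof. by case: jordan_closed_jordan => _ _; apply. Qed.

Lemma jordanZ k a : jordan a -> jordan (k *: a).
Proof. by move=> Ja; rewrite -[_ *: _]addr0; apply: jordanP jordan0. Qed.

Lemma jordanD a b : jordan a -> jordan b -> jordan (a + b).
Proof. by rewrite -{2}[a]scale1r; apply: jordanP. Qed.

Lemma jordanB a b : jordan a -> jordan b -> jordan (a - b).
Proof. by move=> Ja Jb; rewrite addrC -scaleN1r; apply: jordanP. Qed.

Lemma jordan_addKl {a b} : jordan a -> jordan (a + b) -> jordan b.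
Proof. by move=> Ja Jab; rewrite -[b](addKr a) addrC; apply: jordanB. Qed.

Lemma jordan_addKr {a b} : jordan b -> jordan (a + b) -> jordan a.
Proof. by rewrite addrC; apply: jordan_addKl. Qed.

Lemma jordan_mulr2n a : 2%:R != 0 :> K -> jordan (a *+ 2) -> jordan a.
Proof.
move=> two_neq0 /(jordanZ 2%:R^-1).
by rewrite -scaler_nat scalerA mulVf // scale1r.
Qed.

End JordanSubspace.

Section BicomMul.
Context {K : fieldType} {X : Type}.
Implicit Types a b c : Bicom K X.

Lemma bicom_mulDr a b c : a ** (b + c) = a ** b + a ** c.
Proof. by case: (bicom_mulP K X) => /(_ a 1 b c) + _ _ _; rewrite !scale1r. Qed.

Lemma bicom_mulDl a b c : (a + b) ** c = a ** c + b ** c.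
Proof. by case: (bicom_mulP K X) => _ /(_ c 1 a b) + _ _; rewrite !scale1r. Qed.

End BicomMul.

Section SymmetricHooks.
Context {K : fieldType} {X : Type}.
Implicit Types (x y z : X) (xs ys : seq X).

(** This is s(A; B) with A = [x :: xs] and B = [y :: ys]. *)
Definition symhook x xs y ys : Bicom K X := hook K x xs y ys + hook K y ys x xs.

Lemma symhookC x xs y ys : symhook x xs y ys = symhook y ys x xs.
Proof. exact: addrC. Qed.

Lemma symhook_swapl x z xs y ys :
  symhook x (z :: xs) y ys = symhook z (x :: xs) y ys.
Proof. by rewrite /symhook hook_swapl hook_swapr. Qed.

Lemma symhook_swapr x xs y z ys :
  symhook x xs y (z :: ys) = symhook x xs z (y :: ys).
Proof. by rewrite symhookC symhook_swapl symhookC. Qed.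

Lemma symhook_swapr2 x xs y z t ys :
  symhook x xs y [:: z, t & ys] = symhook x xs y [:: t, z & ys].
Proof.
rewrite /symhook -!hook_lmul -!hook_rmul bicom_mulCr.
by congr (_ + _); rewrite bicom_mulCl.
Qed.

(** In base elements, z e(A; B) = e(zA; B) and e(A; B) z = e(A; zB). *)
Lemma anticomm_gen_symhook z x xs y ys :
  anticomm (gen z) (symhook x xs y ys) =
  symhook x (z :: xs) y ys + symhook x xs y (z :: ys).
Proof.
rewrite /anticomm /symhook bicom_mulDl bicom_mulDr !hook_lmul !hook_rmul.
by rewrite (AC (2*2) ((1*4)*(3*2))).
Qed.

(** Right commutativity gives (xy)h = (xh)y. Together with [hook_mul2], a product of two generators
    commutes with every hook. *)
Lemma mul2_hook x y z zs t ts :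
  gen x ** gen y ** hook K z zs t ts = hook K z (x :: zs) t (y :: ts).
Proof. by rewrite bicom_mulCr hook_lmul hook_rmul. Qed.

Lemma hook_mul2 x y z zs t ts :
  hook K z zs t ts ** (gen x ** gen y) = hook K z (x :: zs) t (y :: ts).
Proof. by rewrite bicom_mulCl hook_rmul hook_lmul. Qed.

(** The two orders of the product agree by [mul2_hook] and [hook_mul2], whence the factor 2. *)
Lemma anticomm_symhook2 a b x xs y ys :
  anticomm (symhook a [::] b [::]) (symhook x xs y ys) =
  (symhook x (a :: xs) y (b :: ys) + symhook x (b :: xs) y (a :: ys)) *+ 2.
Proof.
rewrite /anticomm /symhook {1 2 5 6}/hook /= mulr2n !bicom_mulDl !bicom_mulDr.
rewrite !mul2_hook !hook_mul2; congr (_ + _).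
  by rewrite (AC (2*2) ((1*4)*(3*2))).
by rewrite (AC (2*2) ((1*4)*(2*3))).
Qed.

Hypothesis two_neq0 : 2%:R != 0 :> K.

Lemma jordan_symhook x xs y ys : jordan (symhook x xs y ys).
Proof.
have [n] := ubnP (size xs + size ys).
elim: n => // n IH in x xs y ys *; rewrite ltnS => le_n.
have move_letter z x' xs' y' ys' : (size xs' + size ys' < n)%N ->
    jordan (symhook x' (z :: xs') y' ys' + symhook x' xs' y' (z :: ys')).
  move=> lt_n; rewrite -anticomm_gen_symhook.
  by apply: jordan_anticomm; [apply: jordan_gen|apply: IH].
have two_sided a b x' xs' y' ys' : ((size xs' + size ys').+1 < n)%N ->
    jordan (symhook x' (a :: xs') y' (b :: ys')).
  move=> lt_n; have Jdiff : jordan (symhook x' (a :: xs') y' (b :: ys')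
                                  - symhook x' (b :: xs') y' (a :: ys')).
    have lt_Sn : (size xs' + (size ys').+1 < n)%N by rewrite addnS.
    have Ja := move_letter a x' xs' y' (b :: ys') lt_Sn.
    have Jb := move_letter b x' xs' y' (a :: ys') lt_Sn.
    (* Both moves end with [a] and [b] on the right, in either order; this common term cancels. *)
    rewrite -(addrKA (symhook x' xs' y' [:: a, b & ys'])).
    by apply: jordanB => //; rewrite symhook_swapr2 addrC.
  (* For p the goal and q its swap, 2p = (p - q) + (q + p), and 2(q + p) is an anticommutator of
     smaller symmetric hooks. *)
  apply: (jordan_mulr2n _ two_neq0); rewrite mulr2n.
  rewrite -(subrKA (symhook x' (b :: xs') y' (a :: ys'))).
  apply: jordanD => //; apply: (jordan_mulr2n _ two_neq0).
  rewrite addrC -anticomm_symhook2.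
  by apply: jordan_anticomm; apply: IH; [apply: leq_ltn_trans lt_n|apply: ltnW].
wlog le_xy : x xs y ys le_n / (size xs <= size ys)%N => [hwlog|].
  have [|/ltnW] := leqP (size xs) (size ys); first exact: hwlog.
  by rewrite symhookC; apply: hwlog; rewrite addnC.
case: xs ys => [|a xs] [|b ys] //= in le_n le_xy *; last first.
- by apply: two_sided; rewrite -addnS.
- case: ys => [|c ys] /= in le_n le_xy *; last first.
    (* Moving [b] to the left keeps [c] on the right, so both sides have at least two letters. *)
    apply: jordan_addKl (move_letter b x [::] y (c :: ys) _) => //.
    exact: two_sided.
  (* In degree 3 the three sums are {b, s(x; y)}, {y, s(x; b)} and {x, s(y; b)}. *)
  have Juv : jordan (symhook x [::] y [:: b] + symhook y [::] x [:: b]).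
    by rewrite (symhookC y) addrC; apply: move_letter.
  have Juw : jordan (symhook x [::] y [:: b] + symhook b [::] x [:: y]).
    by rewrite (symhookC b) symhook_swapr addrC; apply: move_letter.
  have Jvw : jordan (symhook y [::] x [:: b] + symhook b [::] x [:: y]).
    rewrite (symhook_swapr y) (symhook_swapr b) (symhookC b) addrC.
    exact: move_letter.
  (* Here 2u = (u + v) + (u + w) - (v + w). *)
  apply: (jordan_mulr2n _ two_neq0); rewrite mulr2n; apply: (jordan_addKr Jvw).
  by rewrite (AC (2*2) ((1*3)*(2*4))); apply: jordanD.
- exact: jordan_anticomm (jordan_gen x) (jordan_gen y).
Qed.

End SymmetricHooks.

Section StarAntiMorphism.
Context {K : fieldType} {d : Order.disp_t} {X : orderType d}.
Implicit Types (a b f : Bicom K X).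

Lemma star_gen (x : X) : star K X (gen x) = gen x.
Proof. by case: (starP K X). Qed.

(* The map given by the universal property of Bicom(X), for the opposite
   product, satisfies the specification of [star]. *)
Lemma starM a b : star K X (a ** b) = star K X b ** star K X a.
Proof.
have mulop_bicom : bicommutative (fun a b : Bicom K X => b ** a).
  by case: (bicom_mulP K X) => lr ll cl cr; split=> // u v w; rewrite (cl, cr).
have [s [s_gen sM]] := bicom_lift mulop_bicom gen.
suff s_spec : star_spec s by rewrite !(star_uniq (starP K X) s_spec).
split=> // x xs y ys _ _; elim: xs => [|z xs IHxs]; last first.
  by rewrite -hook_lmul sM s_gen IHxs hook_rmul.
elim: ys => [|z ys IHys]; first by rewrite /hook /= sM !s_gen.
by rewrite -hook_rmul sM s_gen IHys hook_lmul.
Qed.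

Lemma star_jordan f : jordan f -> star K X f = f.
Proof.
move=> Jf; apply: (Jf (fun a => star K X a = a)).
split=> [|_ [x _ <-]]; last exact: star_gen.
split=> [|k a b a_sym b_sym|a b a_sym b_sym]; first exact: linear0.
  by rewrite linearP a_sym b_sym.
by rewrite /anticomm linearD !starM a_sym b_sym addrC.
Qed.

Hypothesis two_neq0 : 2%:R != 0 :> K.

(** By linearity only generators and base elements matter; there the sum is 2x or a [symhook]. *)
Lemma jordan_add_star f : jordan (f + star K X f).
Proof.
elim/bicom_ind: f => [|k a b Ja Jb|x|x xs y ys sxs sys].
- by rewrite linear0 addr0; apply: jordan0.
- by rewrite linearP addrACA -scalerDr; apply: jordanP.
- by rewrite star_gen; apply: jordanD; apply: jordan_gen.
- by case: (starP K X) => _ ->//; apply: jordan_symhook.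
Qed.

End StarAntiMorphism.

Theorem theorem2p5 (K : fieldType) (charK0 : [pchar K] =i pred0)
    (d : Order.disp_t) (X : orderType d) (f : Bicom K X) :
  jordan f <-> star K X f = f.
Proof.
have two_neq0 : 2%:R != 0 :> K by rewrite ((pcharf0P K).1 charK0).
split=> [|f_sym]; first exact: star_jordan.
(* A symmetric f is half of the sum of f and its image under [star]. *)
apply: (jordan_mulr2n _ two_neq0); rewrite mulr2n -{2}f_sym.
exact: jordan_add_star.
Qed.
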